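(* Let $n\ge 5$ be odd, let $q=2^n$, and let $a\in\mathbb{F}_q^{\times}$. Let \[\mathcal{K}(a)=\sum_{x\in\mathbb{F}_{q}}(-1)^{\Tr(x^{q-2}+ax)},\qquad Q(a)=\sum_{0\le i<j<n}a^{2^i+2^j}\in\mathbb{F}_2,\] and let $a^{1/3}$ denote the unique cube root of $a$ in $\mathbb{F}_q$. (1) If $\Tr(a^{1/3})=0$ then \[ \mathcal{K}(a)\equiv\begin{cases} 4 \pmod{48} & \text{if } \Tr(a)=1,\ Q(a)=1,\\ 16 \pmod{48} & \text{if } \Tr(a)=0,\ Q(a)=0,\\ 28 \pmod{48} & \text{if } \Tr(a)=1,\ Q(a)=0,\\ 40 \pmod{48} & \text{if } \Tr(a)=0,\ Q(a)=1. \end{cases} \] (2) If $\Tr(a^{1/3})=1$, let $\beta\in\mathbb{F}_q$ be the unique element with $\Tr(\beta)=0$ and $a^{1/3}=\beta^4+\beta+1$, and regard $\Tr(\beta^3)\in\{0,1\}$ as an integer. Then \[ \mathcal{K}(a)\equiv\begin{cases} 0 \pmod{48} & \text{if } \Tr(a)=0,\ Q(a)=0,\ n+\Tr(\beta^3)\equiv 5,7 \pmod 8,\\ 8 \pmod{48} & \text{if } \Tr(a)=0,\ Q(a)=1,\ n+\Tr(\beta^3)\equiv 1,3 \pmod 8,\\ 12 \pmod{48} & \text{if } \Tr(a)=1,\ Q(a)=0,\ n+\Tr(\beta^3)\equiv 5,7 \pmod 8,\\ 20 \pmod{48} & \text{if } \Tr(a)=1,\ Q(a)=1,\ n+\Tr(\beta^3)\equiv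 1,3 \pmod 8,\\ 24 \pmod{48} & \text{if } \Tr(a)=0,\ Q(a)=1,\ n+\Tr(\beta^3)\equiv 5,7 \pmod 8,\\ 32 \pmod{48} & \text{if } \Tr(a)=0,\ Q(a)=0,\ n+\Tr(\beta^3)\equiv 1,3 \pmod 8,\\ 36 \pmod{48} & \text{if } \Tr(a)=1,\ Q(a)=1,\ n+\Tr(\beta^3)\equiv 5,7 \pmod 8,\\ 44 \pmod{48} & \text{if } \Tr(a)=1,\ Q(a)=0,\ n+\Tr(\beta^3)\equiv 1,3 \pmod 8. \end{cases} \]
   Context: $\Tr:\mathbb{F}_{2^n}\to\mathbb{F}_2$ is the absolute trace $\Tr(c)=c+c^2+\cdots+c^{2^{n-1}}$. Since $n$ is odd, cubing is a bijection of $\mathbb{F}_q$, so $a^{1/3}$ is well defined. Note $x^{q-2}=x^{-1}$ for $x\ne0$ and $0^{q-2}=0$. *)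

(* Defs.v *)
From HB Require Import structures.
From mathcomp Require Import all_boot all_order all_algebra all_field.

Set Implicit Arguments.
Unset Strict Implicit.
Unset Printing Implicit Defensive.

Import GRing.Theory.
Local Open Scope ring_scope.

(* The field F_q, q = 2 ^ n, is any F : finFieldType with #|F| = 2 ^ n.  Its
   prime field F_2 is the subset {0, 1} of F; elements of F_2 stay in F, and
   bit reads them as the integers 0 and 1.  The values of bit outside {0, 1}
   are irrelevant: see absTr_F2 and Q_F2. *)
Definition bit (F : finFieldType) (x : F) : nat := (x == 1).

Definition absTr (F : finFieldType) (n : nat) (c : F) : F :=
  \sum_(i < n) c ^+ (2 ^ i).

Definition Q (F : finFieldType) (n : nat) (a : F) : F :=
  \sum_(j < n) \sum_(i < n | (i < j)%N) a ^+ (2 ^ i + 2 ^ j).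

Definition kloosterman (F : finFieldType) (n : nat) (a : F) : int :=
  \sum_(x : F) (-1) ^+ bit (absTr n (x ^+ (#|F| - 2) + a * x)).

Lemma sqr_idem_F2 (F : finFieldType) (x : F) : x ^+ 2 = x -> x = 0 \/ x = 1.
Proof.
move=> E; have /eqP : x * (x - 1) = 0 by rewrite mulrBr mulr1 -expr2 E subrr.
by rewrite mulf_eq0 subr_eq0 => /orP[] /eqP; [left | right].
Qed.

Lemma sqr_sum_pchar2 (F : finFieldType) (n : nat) (I : Type) (r : seq I)
    (P : pred I) (G : I -> F) : #|F| = (2 ^ n)%N ->
  (\sum_(i <- r | P i) G i) ^+ 2 = \sum_(i <- r | P i) G i ^+ 2.
Proof.
move=> cardF; have ch2 := card_finPcharP cardF isT.
exact: (raddf_sum (pFrobenius_aut ch2)).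
Qed.

Lemma absTr_F2 (F : finFieldType) (n : nat) (c : F) :
  #|F| = (2 ^ n)%N -> absTr n c = 0 \/ absTr n c = 1.
Proof.
move=> cardF; apply: sqr_idem_F2.
rewrite /absTr (sqr_sum_pchar2 _ _ _ cardF).
have cn : c ^+ (2 ^ n) = c by rewrite -cardF expf_card.
case: n cn {cardF} => [|m] cn; first by rewrite !big_ord0.
rewrite big_ord_recr [RHS]big_ord_recl /= -exprM -expnSr cn.
rewrite expr1 addrC; congr (_ + _).
by apply: eq_bigr => i _; rewrite -exprM -expnSr.
Qed.

Lemma Q_F2 (F : finFieldType) (n : nat) (a : F) :
  #|F| = (2 ^ n)%N -> Q n a = 0 \/ Q n a = 1.
Proof.
move=> cardF; pose b i := a ^+ (2 ^ i).
have bS i : b i ^+ 2 = b i.+1 by rewrite /b -exprM -expnSr.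
have bn : b n = b 0 by rewrite /b -cardF expf_card expr1.
have QE : Q n a = \sum_(j < n) \sum_(i < j) b i * b j.
  apply: eq_bigr => j _.
  rewrite (big_ord_widen n (fun i => b i * b j) (ltnW (ltn_ord j))).
  by apply: eq_bigr => i _; rewrite exprD.
have sumE j : (\sum_(i < j) b i * b j) ^+ 2 = \sum_(i < j) b i.+1 * b j.+1.
  rewrite (sqr_sum_pchar2 _ _ _ cardF).
  by apply: eq_bigr => i _; rewrite exprMn !bS.
apply: sqr_idem_F2; rewrite QE (sqr_sum_pchar2 _ _ _ cardF).
under eq_bigr => j _ do rewrite sumE.
case: n bn {cardF QE} => [|m] bn; first by rewrite !big_ord0.
rewrite big_ord_recr [RHS]big_ord_recl /= big_ord0 add0r bn.
under [RHS]eq_bigr => j _ do rewrite big_ord_recl /=.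
rewrite big_split /= addrC; congr (_ + _).
by apply: eq_bigr => i _; rewrite mulrC.
Qed.

(* Main.v *)
(* Write chi x = (-1)^Tr(x) and H = \sum_(Tr(1/y) = 0) chi(ay).  Averaging
   chi(ay) against 1 + chi(1/y) gives K(a) = 2 H = q - 4 N with
   N = #{y | Tr(1/y) = 0, Tr(ay) = 1}.

   Modulo 16: in the Galois ring GR(4, n), let tau(c) be the sum of the
   Teichmueller lifts of the conjugates of c.  Its Witt coordinates are
   (Tr c, Q c), and tau(c)^2 is the bit Tr(c).  Expanding
   \sum_y (1 - tau(1/y)^2) tau(ay)^2, only the terms with
   2^i + 2^j = 2^k + 2^l survive, and N = tau(a) = Tr(a) + 2 Q(a) modulo 4.

   Modulo 3: D(y) = y^3 + y permutes {Tr(1/y) = 0} and is 3-to-1 on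
   {Tr(1/y) = 1} minus {1}, so C = \sum_y chi(a D(y)) = H + 1 and
   K(a) = 2 C + 1.  With c^3 = a, C = \sum_y chi(y^3 + c y): the shift
   y -> y + 1 shows C = 0 if Tr c = 0, and y -> y + b^2 reduces
   c = b^4 + b + 1 to c = 1.

   Finally \sum_y chi(y^3 + y) = (1 + i)^n + (1 - i)^n, by induction over the
   subfields F_(2^m): both sides have square 2^(m + 1), and both are unchanged
   modulo an odd prime p when m is replaced by m p, on the left because x -> x^(2^m)
   acts with orbits of size 1 or p, on the right by Frobenius. *)
From HB Require Import structures.
Require Import Defs.
From mathcomp Require Import all_boot all_order all_algebra all_fingroup all_solvable all_field.
From mathcomp Require Import ring zify.

Import GRing.Theory Num.Theory.
Local Open Scope ring_scope.

Set Implicit Arguments.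
Unset Strict Implicit.
Unset Printing Implicit Defensive.

(** * Trace and additive character in characteristic 2 *)

Definition addchar (F : finFieldType) (n : nat) (x : F) : int :=
  (-1) ^+ bit (absTr n x).

Section Characteristic2.

Variables (F : fieldType) (ch2 : 2%N \in [pchar F]).

Lemma addxx (x : F) : x + x = 0.
Proof. exact: addrr_pchar2 ch2 x. Qed.

Lemma two0 : 2%:R = 0 :> F.
Proof. exact: addxx 1. Qed.

Lemma opp_F (x : F) : - x = x.
Proof. exact: oppr_pchar2 ch2 x. Qed.

Lemma eq_addP (x y : F) : (x + y == 0) = (x == y).
Proof. by rewrite addr_eq0 opp_F. Qed.

Lemma exp2D (x y : F) i : (x + y) ^+ (2 ^ i) = x ^+ (2 ^ i) + y ^+ (2 ^ i).
Proof. by rewrite exprDn_pchar // (eq_pnat _ (pcharf_eq ch2)) pnatX pnat_id. Qed.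

Lemma sqrD (x y : F) : (x + y) ^+ 2 = x ^+ 2 + y ^+ 2.
Proof. exact: (exp2D x y 1). Qed.

End Characteristic2.

Section AdditiveCharacter.

Variables (n : nat) (F : finFieldType).
Hypotheses (odd_n : odd n) (cardF : #|F| = (2 ^ n)%N).

Local Notation Tr := (@absTr F n).
Local Notation chi := (@addchar F n).

Lemma pchar_F2 : 2%N \in [pchar F].
Proof. exact: card_finPcharP cardF isT. Qed.

Let ch2 := pchar_F2.

Lemma expF (x : F) : x ^+ (2 ^ n) = x.
Proof. by rewrite -cardF expf_card. Qed.

Lemma TrD x y : Tr (x + y) = Tr x + Tr y.
Proof. by rewrite /absTr -big_split; apply: eq_bigr => i _; rewrite /= exp2D. Qed.

Lemma Tr_sqrE x : Tr (x ^+ 2) = Tr x ^+ 2.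
Proof.
rewrite {2}/absTr (sqr_sum_pchar2 _ _ _ cardF).
by apply: eq_bigr => i _; rewrite -!exprM mulnC.
Qed.

Lemma Tr_sqr x : Tr (x ^+ 2) = Tr x.
Proof. by rewrite Tr_sqrE; case: (absTr_F2 x cardF) => ->; rewrite ?expr0n ?expr1n. Qed.

Lemma Tr0 : Tr 0 = 0.
Proof. by apply: (addrI (Tr 0)); rewrite -TrD !addr0. Qed.

Lemma Tr1 : Tr 1 = 1.
Proof.
rewrite /absTr (eq_bigr (fun=> 1)) => [|i _]; last by rewrite expr1n.
rewrite sumr_const card_ord -(odd_double_half n) odd_n mulrS.
by rewrite -mul2n mulrnA (two0 ch2) mul0rn addr0.
Qed.

Lemma chiE x : chi x = 1 - 2 * (Tr x == 1)%:R.
Proof. by rewrite /addchar /bit; case: (_ == 1). Qed.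

Lemma chiP x : Tr x = 0 /\ chi x = 1 \/ Tr x = 1 /\ chi x = -1.
Proof.
rewrite /addchar; case: (absTr_F2 x cardF) => ->; [left | right]; rewrite /bit ?eqxx //.
by rewrite eq_sym oner_eq0.
Qed.

Lemma eq_chi x y : Tr x = Tr y -> chi x = chi y.
Proof. by rewrite /addchar => ->. Qed.

Lemma chi0 : chi 0 = 1.
Proof. by rewrite /addchar Tr0 /bit eq_sym oner_eq0. Qed.

Lemma chiD x y : chi (x + y) = chi x * chi y.
Proof.
rewrite /addchar TrD; case: (absTr_F2 x cardF) => ->; case: (absTr_F2 y cardF) => ->;
  by rewrite /bit ?addr0 ?add0r ?(addxx ch2) ?eqxx // ?[0 == 1]eq_sym oner_eq0.
Qed.

Lemma chi_sqr x : chi (x ^+ 2) = chi x.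
Proof. by apply: eq_chi; rewrite Tr_sqr. Qed.

Lemma bij_add (y : F) : bijective (fun x : F => x + y).
Proof. by exists (fun x => x - y) => x; rewrite ?addrK ?subrK. Qed.

Lemma bij_mul (y : F) : y != 0 -> bijective (fun x : F => x * y).
Proof. by move=> y0; exists (fun x => x / y) => x; rewrite ?mulfK ?divfK. Qed.

Lemma bij_sqr : bijective (fun x : F => x ^+ 2).
Proof. exact: injF_bij (fmorph_inj (pFrobenius_aut ch2)). Qed.

Lemma reindex_sum (f : F -> F) (g : F -> int) : bijective f ->
  \sum_x g x = \sum_x g (f x).
Proof. by move=> bf; apply: (reindex f); exact: onW_bij. Qed.

(** Shifting x by [a^-1] adds 1 to a x, and Tr 1 = 1 because n is odd, so the sum equals its own
    negative. *)
Lemma sum_chi_linear (a : F) : a != 0 -> \sum_x chi (a * x) = 0.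
Proof.
move=> a0; suff E : \sum_x chi (a * x) = - \sum_x chi (a * x) by lia.
rewrite [LHS](reindex_sum _ (bij_add a^-1)) -sumrN; apply: eq_bigr => x _.
by rewrite mulrDr divff // chiD {2}/addchar Tr1 /bit eqxx mulrN1.
Qed.

Lemma prim_rootF : exists g : F, (2 ^ n).-1.-primitive_root g.
Proof.
have q1 : (0 < (2 ^ n).-1)%N by have := leq_exp2l 1 n (isT : (1 < 2)%N); rewrite odd_gt0 //; lia.
have sz : size [seq x <- enum F | x != 0] = (2 ^ n).-1.
  by rewrite -cardF -(cardC1 (0 : F)) cardE enumT; congr size; rewrite /enum_mem; apply: eq_filter.
have /hasP[g _ g_prim] : has (2 ^ n).-1.-primitive_root [seq x : F <- enum F | x != 0].
  apply: has_prim_root; rewrite ?sz //; last exact: filter_uniq (enum_uniq F).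
  apply/allP => x; rewrite mem_filter => /andP[x0 _]; rewrite unity_rootE.
  by apply/eqP; apply: (mulfI x0); rewrite -exprS prednK ?expn_gt0 // mulr1 expF.
by exists g.
Qed.

End AdditiveCharacter.

(** * Kloosterman sums modulo 3 and cubic sums *)

Section CubicSums.

Variables (n : nat) (F : finFieldType).
Hypotheses (odd_n : odd n) (cardF : #|F| = (2 ^ n)%N).

Let ch2 : 2%N \in [pchar F] := pchar_F2 cardF.

Local Notation Tr := (@absTr F n).
Local Notation chi := (@addchar F n).

(** Since [0^-1 = 0], the index y = 0 lies in the range and contributes 1. *)
Definition halfsum (a : F) : int := \sum_(y | Tr y^-1 == 0) chi (a * y).

Lemma kloosterman_halfsum (a : F) : (2 < #|F|)%N -> a != 0 ->
  kloosterman n a = 2 * halfsum a.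
Proof.
move=> F2 a0.
have -> : kloosterman n a = \sum_x chi x^-1 * chi (a * x).
  apply: eq_bigr => x _; rewrite -chiD // /addchar; congr (_ ^+ bit (Tr (_ + _))).
  (* The bound on [#|F|] makes the exponent q - 2 positive, so 0 is sent to 0, in agreement with
     [0^-1 = 0]. *)
  have [->|x0] := eqVneq x 0; first by rewrite invr0 expr0n; case: #|F| F2 => [|[|[]]].
  apply: (mulfI x0); rewrite divff //; apply: (mulfI x0).
  by rewrite mulr1 mulrA -expr2 -exprD subnKC ?expf_card // ltnW.
rewrite -[LHS]addr0 -[X in _ + X](sum_chi_linear odd_n cardF a0) -big_split /=.
rewrite (bigID (fun y => Tr y^-1 == 0)) /= [X in _ + X]big1 ?addr0 => [|x Hx].
  rewrite mulr_sumr; apply: eq_bigr => x /eqP Hx.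
  by case: (chiP cardF x^-1) => [[_ ->]|[]]; [lia | rewrite Hx => /esym/eqP; rewrite oner_eq0].
by case: (chiP cardF x^-1) => [[E _]|[_ ->]]; [rewrite E eqxx in Hx | lia].
Qed.

(** The Dickson polynomial X^3 - 3 X read in characteristic 2: it sends t + 1/t to t^3 + 1/t^3. *)
Definition dickson3 (y : F) := y ^+ 3 + y.

(** For odd n, 2^n = 2 modulo 3, so w^3 = 1 gives w = w^(2^n) = w^2 and hence w = 1. *)
Lemma odd_cube_inj : injective (fun y : F => y ^+ 3).
Proof.
have cube1 (w : F) : w ^+ 3 = 1 -> w = 1.
  move=> w3; have w0 : w != 0 by apply/eqP => w0; move/eqP: w3; rewrite w0 expr0n eq_sym oner_eq0.
  have := expF cardF w; rewrite -(expr_mod _ w3).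
  have -> : (2 ^ n %% 3 = 2)%N.
    rewrite -(odd_double_half n) odd_n -mul2n add1n expnS expnM -modnMmr -modnXm.
    by rewrite exp1n.
  by move=> E; apply: (mulfI w0); rewrite mulr1 -expr2.
move=> x y /= E; have [y0|y0] := eqVneq y 0.
  by move: E; rewrite y0 expr0n => /eqP; rewrite expf_eq0 => /andP[_ /eqP].
apply: (mulIf (invr_neq0 y0)); rewrite divff //; apply: cube1.
by rewrite expr_div_n E divff // expf_neq0.
Qed.

(** The half-trace of u is a solution: z^2 + z is the sum of u^(2^i) for i <= n, that is Tr u +
    u. *)
Lemma hilbert90 (u : F) : Tr u = 0 -> exists z : F, z ^+ 2 + z = u.
Proof.
move=> Tu; pose z k := \sum_(i < k) u ^+ (2 ^ i.*2).
have zE k : z k ^+ 2 + z k = \sum_(i < k.*2) u ^+ (2 ^ i).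
  elim: k => [|k IH]; first by rewrite /z !big_ord0 expr0n addr0.
  rewrite doubleS !big_ord_recr /= -IH /z big_ord_recr /= sqrD // -exprM -expnSr.
  by ring.
exists (z n./2.+1); rewrite zE -[RHS](expF cardF u).
have -> : (n./2.+1.*2 = n.+1)%N by rewrite -[in RHS](odd_double_half n) odd_n doubleS.
by rewrite big_ord_recr /= -/(absTr n u) Tu add0r.
Qed.

(** Partial fractions of 1 / (y (y + 1)^2): besides 1/y there remain 1/(y + 1) and its square, whose
    traces cancel. *)
Lemma Tr_inv_dickson3 (y : F) : y != 1 -> Tr (dickson3 y)^-1 = Tr y^-1.
Proof.
move=> y1; have [->|y0] := eqVneq y 0.
  by rewrite /dickson3 expr0n addr0.
have y10 : y + 1 != 0 by rewrite (eq_addP ch2).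
have -> : (dickson3 y)^-1 = y^-1 + ((y + 1)^-1 + (y + 1)^-1 ^+ 2).
  have -> : dickson3 y = y * (y + 1) ^+ 2.
    by rewrite /dickson3; ring: (two0 ch2).
  rewrite -[X in _ = _ + X](opp_F ch2); field; exact/andP.
by rewrite !TrD // Tr_sqr // addxx // addr0.
Qed.

(* Dividing X^3 + X + D(y) by X - y leaves X^2 + y X + y^2 + 1, and X = y w turns
   this into an Artin-Schreier equation in w, so the other two roots lie in F iff
   Tr (1 + 1/y^2) = 0. *)
Lemma dickson3_eq (y z : F) : y != 0 ->
  dickson3 z = dickson3 y -> z != y -> (z / y) ^+ 2 + z / y = 1 + y^-1 ^+ 2.
Proof.
move=> y0 E zy; have E1 : z ^+ 2 + z * y + y ^+ 2 + 1 = 0.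
  have: (z - y) * (z ^+ 2 + z * y + y ^+ 2 + 1) = 0.
    by rewrite -[RHS](subrr (dickson3 y)) -{1}E /dickson3; ring.
  by move/eqP; rewrite mulf_eq0 subr_eq0 (negbTE zy) => /eqP.
apply/eqP; rewrite -(eq_addP ch2); apply/eqP.
rewrite -[RHS](mul0r (y^-1 ^+ 2)) -E1.
by field.
Qed.

Lemma dickson3_fiber_Tr (y z : F) : y != 0 ->
  dickson3 z = dickson3 y -> z != y -> Tr y^-1 = 1.
Proof.
move=> y0 E zy; have := congr1 Tr (dickson3_eq y0 E zy).
rewrite !TrD // !Tr_sqr // addxx // Tr1 // => /esym/eqP.
by rewrite (eq_addP ch2) => /eqP.
Qed.

(** [dickson3] permutes the index set: two points with the same image would force trace 1, and the
    set is stable by [Tr_inv_dickson3]. *)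
Lemma sum_T0_dickson3 (g : F -> int) :
  \sum_(y | Tr y^-1 == 0) g (dickson3 y) = \sum_(y | Tr y^-1 == 0) g y.
Proof.
pose T := [set y | Tr y^-1 == 0].
have injD : {in T &, injective dickson3}.
  move=> y z; rewrite !inE => /eqP Ty /eqP Tz E; apply/eqP; apply/negPn/negP => yz.
  (* [dickson3_fiber_Tr] needs a nonzero base point; of two distinct points at least one
     qualifies. *)
  have [y0|y0] := eqVneq y 0; last first.
    have := dickson3_fiber_Tr y0 (esym E); rewrite eq_sym Ty => /(_ yz)/esym/eqP.
    by rewrite oner_eq0.
  have z0 : z != 0 by rewrite -y0 eq_sym.
  by have := dickson3_fiber_Tr z0 E yz; rewrite Tz => /esym/eqP; rewrite oner_eq0.
have TE : dickson3 @: T = T.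
  apply/eqP; rewrite eqEcard card_in_imset // leqnn andbT.
  apply/subsetP => _ /imsetP[y Ty ->]; move: Ty; rewrite !inE => Ty.
  rewrite Tr_inv_dickson3 //; apply: contraTneq Ty => ->.
  by rewrite invr1 Tr1 // oner_eq0.
have inT y : (Tr y^-1 == 0) = (y \in T) by rewrite inE.
rewrite (eq_bigl _ _ inT) [RHS](eq_bigl _ _ inT) -{2}TE.
by rewrite big_imset.
Qed.

(** A nonempty fiber is {y, z y, (z + 1) y} with z^2 + z = 1 + 1/y^2, solvable because the right
    side has trace 1 + 1 = 0. As v is not 0, y is neither 0 nor 1; then z is neither 0 nor 1, so the
    three points are distinct. *)
Lemma card_fiber_T1 (v : F) : v != 0 ->
  (3 %| #|[set y | (Tr y^-1 == 1)%R && (dickson3 y == v)]|)%N.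
Proof.
move=> v0; set S := [set y | _]; have [->|[y]] := set_0Vmem S; first by rewrite cards0.
rewrite inE => /andP[/eqP Ty /eqP Dy].
have y0 : y != 0 by apply: contraNneq v0 => y0; rewrite -Dy y0 /dickson3 expr0n addr0.
have y1 : y^-1 ^+ 2 + 1 != 0.
  rewrite -[X in _ + X](expr1n _ 2) -sqrD // expf_eq0 /= eq_addP //.
  apply: contraNneq v0 => /(congr1 GRing.inv); rewrite invrK invr1 => y1.
  by rewrite -Dy y1 /dickson3 expr1n addxx.
have [z zE] : exists z : F, z ^+ 2 + z = 1 + y^-1 ^+ 2.
  by apply: hilbert90; rewrite TrD // Tr_sqr // Tr1 // Ty addxx.
have z0 : z != 0 by apply: contraNneq y1 => z0; rewrite addrC -zE z0 expr0n addr0.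
have z1 : z != 1 by apply: contraNneq y1 => z1; rewrite addrC -zE z1 expr1n addxx.
have root_in w : w != 1 -> w != 0 -> w ^+ 2 + w = 1 + y^-1 ^+ 2 -> w * y \in S.
  move=> w1 w0 wE.
  have Dw : dickson3 (w * y) = dickson3 y.
    apply/eqP; rewrite -(eq_addP ch2) /dickson3.
    have -> : (w * y) ^+ 3 + w * y + (y ^+ 3 + y) =
      y ^+ 3 * ((w + 1) * (w ^+ 2 - w + (1 + y^-1 ^+ 2))) by field.
    by rewrite (opp_F ch2) wE addxx // !mulr0.
  rewrite inE Dw Dy eqxx andbT; apply/eqP.
  apply: (dickson3_fiber_Tr _ (esym Dw)); first by rewrite mulf_neq0.
  by rewrite -subr_eq0 -{1}(mul1r y) -mulrBl mulf_neq0 // subr_eq0 eq_sym.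
have -> : S = [set y; z * y; (z + 1) * y].
  apply/setP => x; apply/idP/idP => [|]; last first.
    rewrite !inE -orbA => /or3P[] /eqP ->.
    - by rewrite Ty Dy !eqxx.
    - by have := root_in z z1 z0 zE; rewrite inE.
    have := root_in (z + 1); rewrite inE; apply.
    - by rewrite -subr_eq0 addrK.
    - by rewrite eq_addP.
    by rewrite sqrD // expr1n addrACA addxx // addr0.
  rewrite !inE => /andP[_ /eqP Dx]; have [//|xy /=] := eqVneq x y.
  have xE := dickson3_eq y0 (etrans Dx (esym Dy)) xy.
  have /eqP : (x / y + z) * (x / y + (z + 1)) = 0.
    by rewrite -[RHS](addxx ch2 (z ^+ 2 + z)) {1}zE -xE; ring: (two0 ch2).
  by rewrite mulf_eq0 !eq_addP // => /orP[] /eqP <-; rewrite divfK ?eqxx ?orbT.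
have inj w w' : (w * y == w' * y) = (w == w') by rewrite (inj_eq (mulIf y0)).
have inj1 w : (w * y == y) = (w == 1) by rewrite -{2}(mul1r y) inj.
rewrite setUC cardsU1 cards2 !inE inj !inj1 [y == _]eq_sym inj1 (negbTE z1).
by rewrite -[z + 1 == 1]subr_eq0 addrK (negbTE z0) -[_ == z]subr_eq0 addrAC subrr add0r oner_eq0.
Qed.

Definition cubicsum (c : F) : int := \sum_y chi (y ^+ 3 + c * y).

(* Outside y = 1 the fibers of dickson3 on {Tr y^-1 = 1} have 0 or 3 elements. *)
Lemma sum_T1_dickson3 (g : F -> int) :
  (\sum_(y | (Tr y^-1 == 1)%R) g (dickson3 y) = g 0%R %[mod 3])%Z.
Proof.
rewrite (partition_big dickson3 predT) //= (bigD1 0) //=.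
(* D(y) = y (y + 1)^2 vanishes at 0 and 1 only, and y = 0 is excluded because Tr [0^-1] = 0. *)
rewrite (big_pred1 1) => [|y]; last first.
  apply/andP/eqP => [[/eqP Ty D0]|->]; last by rewrite invr1 Tr1 // /dickson3 expr1n addxx.
  have : y * (y + 1) ^+ 2 == 0 by rewrite -(eqP D0) /dickson3; apply/eqP; ring: (two0 ch2).
  rewrite mulf_eq0 expf_eq0 /= eq_addP // => /orP[/eqP y0|/eqP //].
  by move/esym/eqP: Ty; rewrite y0 invr0 Tr0 // oner_eq0.
have -> : dickson3 1 = 0 by rewrite /dickson3 expr1n addxx.
apply/eqP; rewrite eqz_mod_dvd addrAC subrr add0r; apply: rpred_sum => v v0.
rewrite (eq_bigr (fun=> g v)) => [|y /andP[_ /eqP ->] //].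
rewrite sumr_const -[_ *+ _]mulr_natr dvdz_mull //.
by have := card_fiber_T1 v0; rewrite cardsE natz.
Qed.

(** Substituting y^2 / c for y turns a D(y) into (y^3 + c y)^2, and chi is unchanged by squaring. *)
Lemma cubicsum_dickson3 (a c : F) : c != 0 -> c ^+ 3 = a ->
  cubicsum c = \sum_y chi (a * dickson3 y).
Proof.
move=> c0 ca; rewrite /cubicsum [RHS](reindex_sum _ (bij_mul (invr_neq0 c0))).
rewrite [RHS](reindex_sum _ (bij_sqr cardF)); apply: eq_bigr => y _.
rewrite -(chi_sqr cardF); congr (chi _).
by rewrite /dickson3 -ca sqrD //; field.
Qed.

Lemma kloosterman_mod3 (a c : F) : (2 < #|F|)%N -> a != 0 -> c ^+ 3 = a ->
  (kloosterman n a = 2 * cubicsum c + 1 %[mod 3])%Z.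
Proof.
move=> F2 a0 ca; rewrite (kloosterman_halfsum F2 a0).
have c0 : c != 0 by apply: contraNneq a0 => c0; rewrite -ca c0 expr0n.
rewrite (cubicsum_dickson3 c0 ca) (bigID (fun y => Tr y^-1 == 0)) /=.
rewrite (sum_T0_dickson3 (fun y => chi (a * y))) -/(halfsum a).
rewrite (eq_bigl (fun y => Tr y^-1 == 1)) => [|y]; last first.
  by case: (absTr_F2 y^-1 cardF) => ->; rewrite ?eqxx ?oner_eq0 // eq_sym oner_eq0.
have := sum_T1_dickson3 (fun y => chi (a * y)); rewrite mulr0 (chi0 cardF).
move: (halfsum a) (\sum_(y | Tr y^-1 == 1) _) => H T; lia.
Qed.

(** The shift y -> y + 1 adds y^2 + y + 1 + c, of trace 1, so every sign flips. *)
Lemma cubicsum_Tr0 c : Tr c = 0 -> cubicsum c = 0.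
Proof.
move=> Tc; suff E : cubicsum c = - cubicsum c by lia.
rewrite {1}/cubicsum (reindex_sum _ (bij_add 1)) -sumrN; apply: eq_bigr => y _.
have -> : (y + 1) ^+ 3 + c * (y + 1) = (y ^+ 3 + c * y) + ((y ^+ 2 + y) + (1 + c))
    + 2%:R * (y ^+ 2 + y) by ring.
rewrite (two0 ch2) mul0r addr0 chiD // [X in _ * X = _]/addchar.
rewrite !TrD // Tr_sqr // addxx // Tr1 // Tc add0r addr0.
by rewrite /bit eqxx mulrN1.
Qed.

(** Shifting by b^2 cancels y b^4 and leaves the cross terms b y + (b y)^2, of trace 0; the constant
    b^3 + b^2 has the trace of b^3 + b. *)
Lemma cubicsum_shift b : cubicsum (b ^+ 4 + b + 1) = chi (b ^+ 3 + b) * cubicsum 1.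
Proof.
rewrite {1}/cubicsum (reindex_sum _ (bij_add (b ^+ 2))) mulr_sumr; apply: eq_bigr => y _.
rewrite -chiD //; apply: eq_chi.
have -> : (y + b ^+ 2) ^+ 3 + (b ^+ 4 + b + 1) * (y + b ^+ 2)
  = y ^+ 3 + 1 * y + (b ^+ 3 + b ^+ 2) + (b * y + (b * y) ^+ 2)
    + 2%:R * (y ^+ 2 * b ^+ 2 + y * b ^+ 4 *+ 2 + b ^+ 6) by ring.
rewrite (two0 ch2) mul0r addr0.
by rewrite !TrD // !Tr_sqr // addxx // addr0 addrC.
Qed.

(** The additive map b -> b^4 + b has kernel {0, 1} and Tr 1 = 1, so it is injective on the
    trace-zero elements. It maps them to themselves, hence permutes them, and c + 1 is one of
    them. *)
Lemma beta_uniqueness (c : F) : Tr c = 1 ->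
  exists b, unique (fun b : F => Tr b = 0 /\ c = b ^+ 4 + b + 1) b.
Proof.
move=> Tc; pose K := [set b | Tr b == 0]; pose f (b : F) := b ^+ 4 + b.
have f_inj : {in K &, injective f}.
  move=> x y; rewrite !inE => /eqP Tx /eqP Ty E; apply/eqP; rewrite -(eq_addP ch2).
  have /eqP : (x + y) * ((x + y) ^+ 3 + 1) = 0.
    rewrite -(addxx ch2 (f x)) {2}E /f mulrDr mulr1 -exprS.
    by rewrite (exp2D ch2 x y 2) addrACA.
  rewrite mulf_eq0 => /orP[//|]; rewrite (eq_addP ch2 (_ ^+ 3)) -{1}(expr1n F 3).
  rewrite (inj_eq odd_cube_inj) => /eqP xy1.
  by have := congr1 Tr xy1; rewrite Tr1 // TrD // Tx Ty addr0 => /esym/eqP; rewrite oner_eq0.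
have fK : f @: K = K.
  apply/eqP; rewrite eqEcard card_in_imset // leqnn andbT.
  apply/subsetP => _ /imsetP[y Ty ->]; move: Ty; rewrite !inE => /eqP Ty.
  by rewrite /f TrD // -[4%N]/(2 * 2)%N exprM !Tr_sqr // addxx.
have : c + 1 \in K by rewrite inE TrD // Tr1 // Tc addxx.
rewrite -fK => /imsetP[b bK cE]; exists b; split.
  by move: bK; rewrite inE => /eqP; split=> //; rewrite -[b ^+ 4 + b]/(f b) -cE (addrK_pchar2 ch2).
move=> b' [Tb' cE']; apply: f_inj => //; first by rewrite inE Tb'.
by rewrite -cE cE' (addrK_pchar2 ch2).
Qed.

End CubicSums.

(* Witt vectors of length 2 for the prime 2: over F_(2^n) this is the Galois ring
   of characteristic 4, whose Teichmueller lift is teich. *)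
Definition witt2 (R : comNzRingType) : Type := (R * R)%type.

HB.instance Definition _ (R : comNzRingType) := Choice.on (witt2 R).

(** * Ring structure on Witt vectors of length 2 *)

Section Witt2Ring.

Variable R : comNzRingType.
Implicit Types x y z : witt2 R.

(** These are the integral formulas for which the ghost components [x.1] and [x.1 ^+ 2 + x.2 *+ 2]
    are additive and multiplicative. *)
Definition witt2_add x y : witt2 R := (x.1 + y.1, x.2 + y.2 - x.1 * y.1).
Definition witt2_opp x : witt2 R := (- x.1, - x.2 - x.1 ^+ 2).
Definition witt2_mul x y : witt2 R :=
  (x.1 * y.1, x.1 ^+ 2 * y.2 + x.2 * y.1 ^+ 2 + x.2 * y.2 *+ 2).

Lemma witt2_addA : associative witt2_add.
Proof. by move=> [? ?] [? ?] [? ?]; congr (_, _) => /=; ring. Qed.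

Lemma witt2_addC : commutative witt2_add.
Proof. by move=> [? ?] [? ?]; congr (_, _) => /=; ring. Qed.

Lemma witt2_add0 : left_id (0, 0) witt2_add.
Proof. by move=> [? ?]; congr (_, _) => /=; ring. Qed.

Lemma witt2_addN : left_inverse (0, 0) witt2_opp witt2_add.
Proof. by move=> [? ?]; congr (_, _) => /=; ring. Qed.

HB.instance Definition _ := GRing.isZmodule.Build (witt2 R)
  witt2_addA witt2_addC witt2_add0 witt2_addN.

Lemma witt2_mulA : associative witt2_mul.
Proof. by move=> [? ?] [? ?] [? ?]; congr (_, _) => /=; ring. Qed.

Lemma witt2_mulC : commutative witt2_mul.
Proof. by move=> [? ?] [? ?]; congr (_, _) => /=; ring. Qed.

Lemma witt2_mul1 : left_id (1, 0) witt2_mul.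
Proof. by move=> [? ?]; congr (_, _) => /=; ring. Qed.

Lemma witt2_mulD : left_distributive witt2_mul witt2_add.
Proof. by move=> [? ?] [? ?] [? ?]; congr (_, _) => /=; ring. Qed.

Lemma witt2_1_neq0 : (1, 0) != 0 :> witt2 R.
Proof. by apply/eqP => -[/eqP]; rewrite oner_eq0. Qed.

HB.instance Definition _ := GRing.Zmodule_isComNzRing.Build (witt2 R)
  witt2_mulA witt2_mulC witt2_mul1 witt2_mulD witt2_1_neq0.

Lemma witt2D x y : x + y = (x.1 + y.1, x.2 + y.2 - x.1 * y.1).
Proof. by []. Qed.

Lemma witt2M x y :
  x * y = (x.1 * y.1, x.1 ^+ 2 * y.2 + x.2 * y.1 ^+ 2 + x.2 * y.2 *+ 2).
Proof. by []. Qed.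

Definition teich (u : R) : witt2 R := (u, 0).

Lemma teichM u v : teich (u * v) = teich u * teich v.
Proof. by rewrite witt2M /=; congr (_, _); ring. Qed.

(** The carries of the successive additions accumulate to minus the second elementary symmetric
    function, the source of Q. *)
Lemma sum_teich m (b : nat -> R) :
  \sum_(i < m) teich (b i) =
    (\sum_(i < m) b i, - \sum_(j < m) \sum_(i < j) b i * b j).
Proof.
elim: m => [|m IH]; first by rewrite !big_ord0 oppr0.
rewrite big_ord_recr /= IH witt2D /= addr0 !big_ord_recr /= opprD.
by rewrite [X in (_, _ - X)]mulr_suml.
Qed.

End Witt2Ring.

Section Witt2Char2.

Variables (F : fieldType) (ch2 : 2%N \in [pchar F]).

(** Lets [power_sum] cancel a factor outside the maximal ideal [x.1 = 0] without constructing
    inverses. *)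
Lemma witt2_reg (x y : witt2 F) : x.1 != 0 -> x * y = 0 -> y = 0.
Proof.
case: x y => [x0 x1] [y0 y1] /= x00; rewrite witt2M /= => -[/eqP].
rewrite mulf_eq0 (negbTE x00) => /eqP -> /eqP.
rewrite expr0n mulr0 addr0 -mulrnAr -mulr_natr (two0 ch2) !mulr0 addr0.
by rewrite mulf_eq0 expf_eq0 (negbTE x00) => /eqP ->.
Qed.

Lemma witt2_two : 2%:R = (0, 1) :> witt2 F.
Proof. by rewrite -[2%:R]/(1 + 1) witt2D /= mulr1 addr0 add0r opp_F // addxx. Qed.

Lemma witt2_four : 4%:R = 0 :> witt2 F.
Proof.
rewrite -[4%N]/(2 * 2)%N natrM witt2_two witt2M /= expr0n /=.
by rewrite !(mul0r, mulr0, add0r) mulr1 mulr2n addxx.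
Qed.

Lemma witt2_mul2 (x : witt2 F) : x.1 = 0 -> x *+ 2 = 0.
Proof.
case: x => [x0 x1] /= ->; rewrite -mulr_natr witt2_two witt2M /=.
by rewrite mulr0 expr0n /= mul0r mulr0 !add0r mulr1 mulr2n addxx.
Qed.

Lemma witt2_natr_mod4 k : k%:R = (k %% 4)%N%:R :> witt2 F.
Proof. by rewrite {1}(divn_eq k 4) natrD natrM witt2_four mulr0 add0r. Qed.

(** Reads the two lowest binary digits of a count off its image in the ring. *)
Lemma witt2_natrE k : k%:R = ((odd k)%:R, (k %% 4 \in [:: 2; 3])%N%:R) :> witt2 F.
Proof.
rewrite witt2_natr_mod4; have : odd k = odd (k %% 4)%N by lia.
have : (k %% 4 < 4)%N by rewrite ltn_mod.
case: (k %% 4)%N => [|[|[|[|//]]]] _ -> //=; first by rewrite witt2_two.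
by rewrite mulrSr witt2_two // witt2D /= add0r mul0r subr0 addr0.
Qed.

End Witt2Char2.

(** * Kloosterman sums modulo 16 *)

Lemma add_pow2_inj i j k l : (i <= j)%N -> (k <= l)%N ->
  (2 ^ i + 2 ^ j = 2 ^ k + 2 ^ l)%N -> i = k /\ j = l.
Proof.
have pos m : (0 < 2 ^ m)%N by rewrite expn_gt0.
elim: i j k l => [|i IH] [|j] [|k] [|l] //=; rewrite ?expn0 ?expnS => ij kl E.
all: try solve [try (have := pos i); try (have := pos j);
  try (have := pos k); try (have := pos l); lia].
  by split=> //; apply: (@expnI 2); rewrite ?expnS; lia.
have [|||-> ->] := IH j k l; rewrite ?expnS; by [|lia].
Qed.

Section KloostermanMod16.

Variables (n : nat) (F : finFieldType).
Hypotheses (odd_n : odd n) (n_gt3 : (3 < n)%N) (cardF : #|F| = (2 ^ n)%N).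

Let ch2 : 2%N \in [pchar F] := pchar_F2 cardF.

Local Notation Tr := (@absTr F n).
Local Notation chi := (@addchar F n).

Definition tau (c : F) : witt2 F := \sum_(i < n) teich (c ^+ (2 ^ i)).

Lemma tauE c : tau c = (Tr c, Q n c).
Proof.
rewrite /tau (sum_teich n (fun i => c ^+ (2 ^ i))) (opp_F ch2); congr (_, _).
apply: eq_bigr => j _.
rewrite (big_ord_widen n (fun i => c ^+ (2 ^ i) * c ^+ (2 ^ j)) (ltnW (ltn_ord j))).
by apply: eq_bigr => i _; rewrite exprD.
Qed.

(** In characteristic 2, squaring in [witt2 F] erases the second coordinate, so the square is an
    indicator of Tr c = 1 inside the ring. *)
Lemma tau_sqr c : tau c ^+ 2 = (Tr c == 1)%:R.
Proof.
rewrite tauE expr2 witt2M /= -[_ *+ 2]mulr_natr (two0 ch2) mulr0 addr0.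
rewrite [Q n c * _]mulrC addxx // -expr2.
by case: (absTr_F2 c cardF) => ->; rewrite ?eqxx ?expr1n // expr0n [0 == 1]eq_sym oner_eq0.
Qed.

Lemma tau_frob c : tau (c ^+ 2) = tau c.
Proof.
rewrite /tau; have := expF cardF c; case: (n) => [|m] cn; first by rewrite !big_ord0.
rewrite big_ord_recr [RHS]big_ord_recl /= -exprM -expnS cn expr1 addrC; congr (_ + _).
by apply: eq_bigr => i _; rewrite -exprM -expnS.
Qed.

Definition wt (p : 'I_n * 'I_n) := (2 ^ p.1 + 2 ^ p.2)%N.

(** A generator of the multiplicative group yields a congruence modulo q - 1, and the weights lie in
    [2, q], a complete system of residues. *)
Lemma eq_expr_wt p r : (forall y : F, y ^+ wt p = y ^+ wt r) -> wt p = wt r.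
Proof.
have [g g_prim] := prim_rootF odd_n cardF; move=> /(_ g)/eqP.
rewrite (eq_prim_root_expr g_prim).
have wt_bound s : (2 <= wt s <= 2 ^ n)%N.
  have pos m : (0 < 2 ^ m)%N by rewrite expn_gt0.
  have lt (i : 'I_n) : (2 ^ i.+1 <= 2 ^ n)%N by rewrite leq_exp2l.
  have := lt s.1; have := lt s.2; have := pos s.1; have := pos s.2.
  by rewrite /wt !expnS; lia.
have := wt_bound p; have := wt_bound r; move: (wt p) (wt r) => A B /andP[B1 B2] /andP[A1 A2].
wlog AB : A B B1 B2 A1 A2 / (A <= B)%N.
  move=> H; case: (leqP A B) => [AB|/ltnW AB]; first exact: H.
  by rewrite eq_sym => E; apply/esym/H.
rewrite eq_sym eqn_mod_dvd // => /dvdnP[[|k]]; rewrite ?mul0n; first by lia.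
by rewrite mulSn; move: (k * _)%N => m; lia.
Qed.

Lemma card_wt_fiber p : #|[pred r | wt p == wt r]| = (p.1 != p.2).+1.
Proof.
case: p => i j; transitivity #|[set (i, j); (j, i)]|.
  apply: eq_card => -[k l]; rewrite !inE /wt /=.
  apply/eqP/orP => [|[]/eqP[-> ->] //]; last by rewrite addnC.
  wlog ij : i j / (i <= j)%N.
    move=> H E; case: (leqP i j) => [ij|/ltnW ij]; first exact: H.
    by case: (H j i ij _) => [|H'|H']; [rewrite addnC | right | left].
  case: (leqP k l) => [kl|/ltnW kl] E.
    by have [/val_inj -> /val_inj ->] := add_pow2_inj ij kl E; left.
  rewrite [RHS]addnC in E; have [/val_inj -> /val_inj ->] := add_pow2_inj ij kl E.
  by right.
by rewrite cards2 xpair_eqE [j == i]eq_sym andbb.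
Qed.

(** For equal weights the nonzero y contribute q - 1 = -1, as 4 divides q. Otherwise some w
    separates the weights; replacing y by y w multiplies the sum by [teich u] with u different from
    1, and [teich u - 1] is regular. *)
Lemma power_sum p r :
  \sum_y teich (y ^+ wt p * y^-1 ^+ wt r) = - (wt p == wt r)%:R :> witt2 F.
Proof.
have wt0 s : (wt s == 0)%N = false by rewrite /wt addn_eq0 !expn_eq0.
have [E|/eqP neq] := eqVneq (wt p) (wt r).
  rewrite (bigD1 0) //= expr0n E wt0 mul0r.
  rewrite -[teich 0]/(0 : witt2 F) add0r (eq_bigr (fun=> 1)) => [|y y0]; last first.
    by rewrite -exprMn divff // expr1n.
  rewrite sumr_const -[#|_|]/#|predC1 (0 : F)| cardC1 cardF -subn1 natrB ?expn_gt0 //.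
  by rewrite -(subnKC n_gt3) expnD -[(2 ^ 4)%N]/(4 * 4)%N natrM natrM witt2_four // !mul0r sub0r.
have [w] : exists w : F, w ^+ wt p != w ^+ wt r.
  apply/existsP; apply: contraT => /existsPn H; case: neq; apply: eq_expr_wt => y.
  by apply/eqP; have := H y; rewrite negbK.
have [->|w0 neqw] := eqVneq w 0; first by rewrite !expr0n !wt0 eqxx.
rewrite oppr0; set S := \sum_y _.
apply: (@witt2_reg _ ch2 (teich (w ^+ wt p * w^-1 ^+ wt r) - 1)).
  rewrite /= subr_eq0; apply: contra neqw => /eqP E.
  by apply/eqP; apply: (mulIf (expf_neq0 (wt r) (invr_neq0 w0))); rewrite E -exprMn divff // expr1n.
rewrite mulrBl mul1r [X in _ - X](reindex _ (onW_bij _ (bij_mul w0))) /= mulr_sumr.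
rewrite -sumrB big1 // => y _; rewrite -teichM; apply/eqP; rewrite subr_eq0; apply/eqP.
by congr teich; rewrite invfM !exprMn; ring.
Qed.

Definition kcount (a : F) := #|[set y | (Tr y^-1 == 0) && (Tr (a * y) == 1)]|.

Lemma sum_bit (a : F) : a != 0 -> (#|[set y | (Tr (a * y) == 1)%R]|.*2 = 2 ^ n)%N.
Proof.
move=> a0; have := sum_chi_linear odd_n cardF a0.
rewrite (eq_bigr (fun y => 1 - 2 * (Tr (a * y) == 1)%:R)) => [|y _]; last exact: chiE.
rewrite sumrB sumr_const -mulr_sumr -natr_sum -[#|_|]/#|F| cardF -sum1_card.
rewrite [X in _ -> (X.*2 = _)%N](eq_bigl (fun y => Tr (a * y) == 1)) => [|y]; last by rewrite inE.
rewrite [X in _ -> (X.*2 = _)%N]big_mkcond /=.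
rewrite (eq_bigr (fun i => if Tr (a * i) == 1 then 1%N else 0%N)) => [|i _]; last by case: (_ == 1).
by move: (\sum_i _)%N => m; lia.
Qed.

Lemma kloosterman_kcount (a : F) : a != 0 ->
  kloosterman n a = (2 ^ n)%N%:Z - 4 * (kcount a)%:Z.
Proof.
move=> a0; rewrite (kloosterman_halfsum odd_n cardF) //; last first.
  by rewrite cardF; apply: (@leq_trans (2 ^ 2)) => //; rewrite leq_exp2l // ltnW // ltnW.
rewrite /halfsum (eq_bigr (fun y => 1 - 2 * (Tr (a * y) == 1)%:R)) => [|y _]; last exact: chiE.
rewrite sumrB sumr_const -mulr_sumr -[#|_|]/#|[pred y | Tr y^-1 == 0]|.
have -> : \sum_(y | Tr y^-1 == 0) (Tr (a * y) == 1)%:R = (kcount a)%:Z.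
  rewrite /kcount -sum1_card -[LHS]natr_sum natz; congr Posz.
  rewrite [RHS](eq_bigl (fun y => (Tr y^-1 == 0) && (Tr (a * y) == 1)));
    last by move=> y; rewrite inE.
  by rewrite [RHS]big_mkcondr; apply: eq_bigr => y _; case: (_ == 1).
(* Inversion carries the complement of the first set onto the second, whose size q/2 comes from
   [sum_bit]; the factor 1 matches its form. *)
have TE : (#|[pred y | (Tr y^-1 == 0)%R]| + #|[set y | (Tr (1 * y) == 1)%R]| = 2 ^ n)%N.
  rewrite -cardF -(cardC [pred y | Tr y^-1 == 0]); congr (_ + _)%N.
  rewrite -(card_imset _ (can_inj invrK)); apply: eq_card => y; rewrite !inE.
  apply/imsetP/idP => [[x] + ->|Ty].
    by rewrite inE invrK mul1r => /eqP ->; rewrite oner_eq0.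
  exists y^-1; rewrite ?invrK // inE mul1r.
  by case: (absTr_F2 y^-1 cardF) Ty => ->; rewrite ?eqxx.
have := sum_bit (oner_neq0 F); move: TE.
by move: #|[pred y | Tr y^-1 == 0]| #|[set y | Tr (1 * y) == 1]| (kcount a) => A B C; lia.
Qed.

Lemma kcount_tau (a : F) : a != 0 -> (kcount a)%:R = tau a.
Proof.
move=> a0.
have -> : (kcount a)%:R = \sum_y tau (a * y) ^+ 2 - \sum_y tau y^-1 ^+ 2 * tau (a * y) ^+ 2.
  rewrite /kcount -sum1_card natr_sum big_mkcond -sumrB /=; apply: eq_bigr => y _.
  rewrite inE !tau_sqr; case: (absTr_F2 y^-1 cardF) => ->;
    rewrite ?eqxx ?oner_eq0 ?[0 == 1]eq_sym ?oner_eq0 /=.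
    by case: (_ == 1); rewrite ?mul0r subr0.
  by rewrite mul1r subrr.
have -> : \sum_y tau (a * y) ^+ 2 = 0.
  rewrite (eq_bigr (fun y => (Tr (a * y) == 1)%:R)) => [|y _]; last exact: tau_sqr.
  rewrite -natr_sum.
  have -> : (\sum_y (Tr (a * y) == 1)%R = #|[set y | (Tr (a * y) == 1)%R]|)%N.
    rewrite -sum1_card big_mkcond [RHS]big_mkcond; apply: eq_bigr => y _.
    by rewrite inE; case: (_ == 1).
  rewrite witt2_natr_mod4 //; have := sum_bit a0.
  rewrite -(subnKC n_gt3) expnD -[(2 ^ 4)%N]/16%N.
  by move: #|_| => m; move=> E; have -> : (m %% 4 = 0)%N by lia.
have tau_sqr_wt c : tau c ^+ 2 = \sum_p teich (c ^+ wt p).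
  rewrite expr2 /tau mulr_suml -(pair_bigA _ (fun i j => teich (c ^+ wt (i, j)))) /=.
  apply: eq_bigr => i _; rewrite mulr_sumr; apply: eq_bigr => j _.
  by rewrite -teichM -exprD.
have -> : \sum_y tau y^-1 ^+ 2 * tau (a * y) ^+ 2 =
    \sum_p \sum_r teich (a ^+ wt p) * \sum_y teich (y ^+ wt p * y^-1 ^+ wt r).
  transitivity (\sum_y \sum_p \sum_r teich (a ^+ wt p) * teich (y ^+ wt p * y^-1 ^+ wt r)).
    apply: eq_bigr => y _; rewrite !tau_sqr_wt mulrC mulr_suml; apply: eq_bigr => p _.
    by rewrite mulr_sumr; apply: eq_bigr => r _; rewrite -!teichM exprMn mulrA.
  rewrite exchange_big; apply: eq_bigr => p _; rewrite exchange_big; apply: eq_bigr => r _.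
  by rewrite mulr_sumr.
(* Only r = (i, j) and r = (j, i) survive for p = (i, j), so off-diagonal terms count twice. *)
have -> : \sum_p \sum_r teich (a ^+ wt p) * \sum_y teich (y ^+ wt p * y^-1 ^+ wt r)
    = - (tau a ^+ 2 + \sum_(p | p.1 != p.2) teich (a ^+ wt p)).
  rewrite tau_sqr_wt [X in _ + X]big_mkcond -big_split -sumrN; apply: eq_bigr => p _ /=.
  rewrite -mulr_sumr (eq_bigr (fun r => - (wt p == wt r)%:R)) => [|r _]; last exact: power_sum.
  have -> : \sum_r - ((wt p == wt r)%:R : witt2 F) = - #|[pred r | wt p == wt r]|%:R.
    rewrite sumrN -natr_sum -sum1_card [in RHS]big_mkcond.
    by congr (- _%:R); apply: eq_bigr => r _; rewrite inE; case: (_ == _).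
  by rewrite card_wt_fiber mulrN; case: (p.1 != p.2); rewrite ?mulr1 ?addr0 // mulr_natr mulr2n.
(* On the diagonal the weight is 2^(i+1), so these terms sum to [tau (a ^+ 2)], which is [tau a]. *)
have diag : tau a ^+ 2 = tau a + \sum_(p | p.1 != p.2) teich (a ^+ wt p).
  rewrite tau_sqr_wt (bigID (fun p => p.1 == p.2)) /= -[tau a]tau_frob; congr (_ + _).
  rewrite -(pair_big_dep xpredT (fun i j => i == j) (fun i j => teich (a ^+ wt (i, j)))) /=.
  apply: eq_bigr => i _; rewrite (big_pred1 i) => [|j]; last by rewrite eq_sym.
  by rewrite /wt /= addnn -mul2n exprM.
(* With E the off-diagonal sum, the count is tau(a) + 2 E. Since E = tau(a)^2 - tau(a) has first
   coordinate 0, 2 E = 0. *)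
rewrite sub0r opprK diag -addrA -mulr2n witt2_mul2 ?addr0 //.
have -> : \sum_(p | p.1 != p.2) teich (a ^+ wt p) = tau a ^+ 2 - tau a by rewrite diag addrC addKr.
rewrite tau_sqr tauE witt2D /=.
by case: (absTr_F2 a cardF) => ->; rewrite ?eqxx ?[0 == 1]eq_sym ?oner_eq0 subrr.
Qed.

Lemma kloosterman_mod16 (a : F) : a != 0 ->
  (kloosterman n a = - 4 * (bit (Tr a) + 2 * bit (Q n a))%N%:Z %[mod 16])%Z.
Proof.
move=> a0; rewrite (kloosterman_kcount a0).
have -> : (2 ^ n = 16 * 2 ^ (n - 4))%N by rewrite -[LHS](congr1 _ (subnKC n_gt3)) expnD.
have := kcount_tau a0; rewrite tauE witt2_natrE // => -[<- <-].
have b01 (b : bool) : bit (b%:R : F) = b by case: b; rewrite /bit ?eqxx // eq_sym oner_eq0.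
rewrite !b01; move: (kcount a) => N; move: (2 ^ _)%N => M.
have : (N %% 4 < 4)%N by rewrite ltn_mod.
by case E : (N %% 4)%N => [|[|[|[|//]]]] _ /=; lia.
Qed.

End KloostermanMod16.

(** * The cubic sum at c = 1 *)

(** Extended by the identity outside [S], [f] becomes a permutation whose p-th power is trivial; it
    generates a p-group acting on [S]. *)
Lemma card_fixpoints_mod (T : finType) (p : nat) (S : {set T}) (f : T -> T) :
  prime p -> {in S, forall x, f x \in S} -> {in S, forall x, iter p f x = x} ->
  #|S| = #|[set x in S | f x == x]| %[mod p].
Proof.
move=> p_prime fS fp; pose g x := if x \in S then f x else x.
have gS x k : x \in S -> iter k g x = iter k f x /\ iter k f x \in S.
  move=> xS; elim: k => //= k [-> kS]; by rewrite /g kS; split=> //; apply: fS.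
have gp x : iter p g x = x.
  have [xS|xS] := boolP (x \in S); first by case: (gS x p xS) => -> _; apply: fp.
  by apply: iter_fix; rewrite /g (negbTE xS).
have g_inj : injective g.
  by apply: (can_inj (g := iter p.-1 g)) => x; rewrite -iterSr prednK ?prime_gt0.
pose s := perm g_inj.
have sp : (s ^+ p = 1)%g.
  apply/permP => x; rewrite perm1 permX -[RHS](gp x); elim: (p) => //= k ->.
  by rewrite permE.
have s_pgroup : (p.-group <[s]>)%g.
  by rewrite /pgroup -orderE; apply: pnat_dvd (pnat_id p_prime); rewrite order_dvdn sp.
have sS : [acts <[s]>%g, on S | 'P]%g.
  rewrite cycle_subG !inE /=; apply/subsetP => x xS; rewrite inE /= apermE permE /g xS.
  exact: fS.
rewrite (pgroup_fix_mod s_pgroup sS) afix_cycle; congr (_ %% _)%N; apply: eq_card => x.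
rewrite !inE; case xS: (x \in S) => //=.
by rewrite sub1set inE apermE permE /g xS.
Qed.

(* (1 + i)^k + (1 - i)^k *)
Fixpoint gauss_trace (k : nat) : int :=
  if k is k'.+1 then
    if k' is k''.+1 then 2 * gauss_trace k' - 2 * gauss_trace k'' else 2
  else 2.

Arguments gauss_trace : simpl never.

Lemma gauss_traceSS k : gauss_trace k.+2 = 2 * gauss_trace k.+1 - 2 * gauss_trace k.
Proof. by []. Qed.

(** Both (1 + i)^4 and (1 - i)^4 equal -4. *)
Lemma gauss_trace4 k : gauss_trace (k + 4) = - 4 * gauss_trace k.
Proof. by rewrite addnC !gauss_traceSS; lia. Qed.

Lemma gauss_trace_sqr k : odd k -> gauss_trace k ^+ 2 = 2 ^+ k.+1.
Proof.
elim/ltn_ind: k => -[|[|[|[|k]]]] IH //= k_odd.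
rewrite -/(gauss_trace k.+4) -[k.+4]addn4 gauss_trace4 exprMn IH; [|lia|lia].
by rewrite -[(k + 4).+1]addSn exprD mulrC.
Qed.

Lemma gauss_trace_mod3 k : odd k ->
  (gauss_trace k = if (k %% 8 < 4)%N then -1 else 1 %[mod 3])%Z.
Proof.
elim/ltn_ind: k => -[|[|[|[|k]]]] IH //= k_odd.
rewrite -/(gauss_trace k.+4) -[k.+4]addn4 gauss_trace4.
have := IH k; case: ifP => k8; case: ifP => k8'; lia.
Qed.

(** x and y are commuting roots of X^2 - 2 X + 2, whose power sums obey the recurrence; the ring may
    be noncommutative so that matrices can be used. *)
Lemma gauss_traceE (R : nzRingType) (x y : R) : GRing.comm x y ->
  x + y = 2%:R -> x * y = 2%:R -> forall k, (gauss_trace k)%:~R = x ^+ k + y ^+ k.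
Proof.
move=> xy add2 mul2; elim/ltn_ind => -[|[|k]] IH; [by rewrite !expr0 | by rewrite !expr1 add2 |].
rewrite gauss_traceSS rmorphB !rmorphM /= !IH //.
rewrite -[2%:~R]/(2%:R) -{1}add2 -mul2 mulrDl !mulrDr.
have -> : x * y * x ^+ k = y * x ^+ k.+1 by rewrite xy -mulrA -exprS.
rewrite -[x * y * _]mulrA -!exprS [y * _ + y ^+ _]addrC addrACA.
by rewrite [x * y ^+ _ + _]addrC addrK.
Qed.

Lemma gauss_trace_prime p m : prime p ->
  (gauss_trace (m * p) = gauss_trace m %[mod p])%Z.
Proof.
(* [A] and its transpose represent 1 + i and 1 - i modulo p. They commute, so Frobenius is additive
   on their powers, and it fixes integers. *)
move=> p_prime; pose A := \matrix_(i < 2, j < 2) (if (i == 1) && (j == 0) then -1 else 1 : 'F_p).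
have A2 : A + A^T = 2%:R.
  by apply/matrixP => -[[|[|//]] i2] [[|[|//]] j2]; rewrite !mxE //=; ring.
have AAT : A *m A^T = 2%:R /\ A^T *m A = 2%:R.
  by split; apply/matrixP => -[[|[|//]] i2] [[|[|//]] j2];
    rewrite !mxE !big_ord_recl big_ord0 !mxE //=; ring.
have AC : GRing.comm A A^T by rewrite /GRing.comm -[LHS]/(A *m A^T) AAT.1 -AAT.2.
have chp : p \in [pchar 'M['F_p]_2].
  rewrite inE p_prime -(rmorph_nat (@scalar_mx 'F_p 2)) /=.
  by rewrite (pcharf0 (pchar_Fp p_prime)) raddf0 eqxx.
have traceE := gauss_traceE AC A2 AAT.1.
have E : (gauss_trace (m * p))%:~R = (gauss_trace m)%:~R :> 'M['F_p]_2.
  rewrite traceE !exprM -!(pFrobenius_autE chp) -pFrobenius_autD_comm; last first.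
    exact/commrX/commr_sym/commrX/commr_sym.
  by rewrite -traceE pFrobenius_aut_int.
apply/eqP; rewrite eqz_mod_dvd (dvdz_pcharf (pchar_Fp p_prime)).
have := congr1 (fun M : 'M_2 => M 0 0) E.
rewrite -!(rmorph_int (@scalar_mx 'F_p 2)) !mxE eqxx !mulr1n => E00.
by rewrite rmorphB /= E00 subrr.
Qed.

Section SubfieldSums.

Variables (n : nat) (F : finFieldType).
Hypotheses (odd_n : odd n) (cardF : #|F| = (2 ^ n)%N).

Let ch2 : 2%N \in [pchar F] := pchar_F2 cardF.

Local Notation Tr := (@absTr F n).
Local Notation chi := (@addchar F n).

Definition subF (m : nat) := [set x : F | x ^+ (2 ^ m) == x].

(* For odd n / m the trace of F restricts on subF m to the trace of subF m, hence
   the full trace in the summand. *)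
Definition subsum (m : nat) : int := \sum_(x in subF m) chi (x ^+ 3 + x).

Lemma subF_add m x y : x \in subF m -> y \in subF m -> x + y \in subF m.
Proof. by rewrite !inE exp2D // => /eqP -> /eqP ->. Qed.

Lemma subF_inv m x : x \in subF m -> x^-1 \in subF m.
Proof. by rewrite !inE exprVn => /eqP ->. Qed.

Lemma subF_exp m x k : x \in subF m -> x ^+ k \in subF m.
Proof. by rewrite !inE exprAC => /eqP ->. Qed.

Lemma card_subF m : (0 < m)%N -> (m %| n)%N -> #|subF m| = (2 ^ m)%N.
Proof.
move=> m0 /dvdnP[k nE]; have [g g_prim] := prim_rootF odd_n cardF.
have pos j : (0 < 2 ^ j)%N by rewrite expn_gt0.
have dn : ((2 ^ m).-1 %| (2 ^ n).-1)%N by rewrite nE mulnC expnM dvdn_pred_predX.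
have z_prim := dvdn_prim_root g_prim dn; set z := g ^+ _ in z_prim.
have -> : subF m = 0 |: [set z ^+ i | i : 'I_(2 ^ m).-1].
  apply/setP => x; rewrite !inE; have [->|x0] /= := eqVneq x 0.
    by rewrite expr0n expn_eq0 /= eqxx.
  rewrite -{1}(prednK (pos m)) exprS -[X in _ == X](mulr1 x) (inj_eq (mulfI x0)).
  apply/eqP/imsetP => [|[i _ ->]]; last by rewrite exprAC (prim_expr_order z_prim) expr1n.
  by move/(prim_rootP z_prim) => [i ->]; exists i.
rewrite cardsU1 card_imset ?card_ord => [|i j]; last first.
  by move/eqP; rewrite (eq_prim_root_expr z_prim) !modn_small // => /eqP/val_inj.
rewrite [_ \in _](_ : _ = false) ?add1n ?prednK //; apply/imsetP => -[i _ /esym/eqP].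
rewrite expf_eq0 => /andP[_ /eqP z0]; have := prim_expr_order z_prim.
rewrite z0 expr0n; case: eqP => [m1|_ /esym/eqP]; last by rewrite oner_eq0.
by have := prim_order_gt0 z_prim; rewrite m1.
Qed.

Lemma sum_subF_shift m (g : F -> int) y : y \in subF m ->
  \sum_(x in subF m) g x = \sum_(x in subF m) g (x + y).
Proof.
move=> yS; rewrite (reindex _ (onW_bij _ (bij_add y))) /=; apply: eq_bigl => x.
by apply/idP/idP => xS; [rewrite -(addrK_pchar2 ch2 y x) | ]; apply: subF_add.
Qed.

(** Shifting x by the square root of [u^-1], which again lies in [subF m], adds 1 to x^2 u and flips
    every sign. *)
Lemma sum_subF_linear m u : u \in subF m -> u != 0 ->
  \sum_(x in subF m) chi (x ^+ 2 * u) = 0.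
Proof.
move=> uS u0; have [h hK] := bij_sqr cardF; move=> Kh.
have sS : h u^-1 \in subF m.
  rewrite inE; apply/eqP/(can_inj hK); rewrite /= exprAC Kh.
  by have := subF_inv uS; rewrite inE => /eqP.
suff E : \sum_(x in subF m) chi (x ^+ 2 * u) = - \sum_(x in subF m) chi (x ^+ 2 * u) by lia.
rewrite [LHS](sum_subF_shift _ sS) -sumrN; apply: eq_bigr => x _.
rewrite sqrD // Kh mulrDl mulVf // chiD // [X in _ * X = _]/addchar Tr1 //.
by rewrite /bit eqxx mulrN1.
Qed.

(** Expanding the square over pairs (x, x + y), the cross terms x^2 y + x y^2 have the trace of x^2
    (y + y^4). The sum over x vanishes unless y^4 = y, that is y = 0 or y = 1, and each of these
    gives 2^m. *)
Lemma subsum_sqr m : (0 < m)%N -> (m %| n)%N -> subsum m ^+ 2 = 2 ^+ m.+1.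
Proof.
move=> m0 mn; rewrite expr2 {1}/subsum mulr_suml.
transitivity (\sum_(y in subF m) chi (y ^+ 3 + y) *
    \sum_(x in subF m) chi (x ^+ 2 * (y + y ^+ 4))).
  under eq_bigr => x xS do rewrite mulr_sumr (sum_subF_shift _ xS).
  rewrite exchange_big /=; apply: eq_bigr => y yS; rewrite mulr_sumr; apply: eq_bigr => x xS.
  rewrite -!chiD //; apply: eq_chi.
  have -> : x ^+ 3 + x + ((y + x) ^+ 3 + (y + x)) =
      y ^+ 3 + y + (x ^+ 2 * y + x * y ^+ 2) + 2%:R * (x ^+ 3 + x + x ^+ 2 * y + x * y ^+ 2).
    by ring.
  rewrite (two0 ch2) mul0r addr0 !TrD // mulrDr TrD //; congr (_ + (_ + _)).
  by rewrite -(Tr_sqr cardF (x * _)) exprMn -exprM.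
have S1 : 1 \in subF m by rewrite inE expr1n.
have S0 : 0 \in subF m by rewrite inE expr0n expn_eq0 /= eqxx.
rewrite (bigD1 0) //= [X in _ + X](bigD1 1) /= ?S1 ?oner_eq0 //.
rewrite [X in _ + (_ + X)]big1 => [|y /andP[/andP[yS y0] y1]].
  rewrite !expr1n !expr0n /= !addr0 addxx // !chi0 // !mul1r.
  rewrite (eq_bigr (fun=> 1)) => [|x _]; last by rewrite mulr0 chi0.
  by rewrite sumr_const card_subF // exprS mulr_natl natrX mulr2n.
rewrite sum_subF_linear ?mulr0 //; first by rewrite subF_add // subF_exp.
rewrite -[X in X + _]mulr1 exprS -mulrDr mulf_neq0 // eq_addP //.
by rewrite eq_sym -[X in _ == X](expr1n _ 3) (inj_eq (odd_cube_inj odd_n cardF)).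
Qed.

Lemma subsum_prime p m : prime p -> (subsum (m * p) = subsum m %[mod p])%Z.
Proof.
move=> p_prime; pose f (x : F) := x ^+ (2 ^ m).
pose T1 k := [set x in subF k | Tr (x ^+ 3 + x) == 1].
have iterf k x : iter k f x = x ^+ (2 ^ (m * k)).
  by elim: k => [|k /= ->]; rewrite ?muln0 // /f -exprM -expnD mulnSr.
have fix_sub x : x \in subF m -> x \in subF (m * p).
  rewrite !inE -/(f x) -iterf => /eqP fx; apply/eqP.
  by elim: (p) => //= k ->.
have fS : {in subF (m * p), forall x, f x \in subF (m * p)} by move=> x; exact: subF_exp.
have fp : {in subF (m * p), forall x, iter p f x = x}.
  by move=> x; rewrite iterf inE => /eqP.
have Tr_f x : Tr (f x ^+ 3 + f x) = Tr (x ^+ 3 + x).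
  rewrite /f exprAC -exp2D //; elim: (m) => [|j IH]; first by rewrite expr1.
  by rewrite expnSr exprM Tr_sqr.
(* The signed sum becomes a difference of two counts, to each of which [card_fixpoints_mod]
   applies. *)
have subsumE k : subsum k = #|subF k|%:Z - 2 * #|T1 k|%:Z.
  rewrite /subsum (eq_bigr (fun x => 1 - 2 * (Tr (x ^+ 3 + x) == 1)%:R));
    last by move=> x _; exact: chiE.
  rewrite sumrB sumr_const -mulr_sumr -natr_sum !natz; congr (_ - 2 * Posz _).
  rewrite -sum1_card big_mkcond [RHS]big_mkcond; apply: eq_bigr => x _.
  by rewrite [in RHS]inE; case: (x \in _); case: (_ == 1).
have cardS := card_fixpoints_mod p_prime fS fp.
have cardT : #|T1 (m * p)%N| = #|T1 m| %[mod p].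
  rewrite (@card_fixpoints_mod _ p _ f) // => [|x|x]; last 2 first.
  - by rewrite !inE Tr_f => /andP[xS ->]; rewrite andbT; have := fS x; rewrite !inE; apply.
  - by rewrite inE => /andP[/fp].
  congr (_ %% _)%N; apply: eq_card => x; rewrite !inE -/(f x).
  case fx: (f x == x); rewrite ?andbF ?andbT //=.
  by have := fix_sub x; rewrite !inE -/(f x) fx => ->.
have cardS' : #|subF (m * p)| = #|subF m| %[mod p].
  rewrite cardS; congr (_ %% _)%N; apply: eq_card => x; rewrite !inE -/(f x) andbC.
  by case fx: (f x == x) => //=; have := fix_sub x; rewrite !inE -/(f x) fx => ->.
rewrite !subsumE; apply/eqP; rewrite eqz_mod_dvd.
have /eqP : (#|subF (m * p)|%:Z = #|subF m|%:Z %[mod p])%Z by rewrite !modz_nat cardS'.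
have /eqP : (#|T1 (m * p)%N|%:Z = #|T1 m|%:Z %[mod p])%Z by rewrite !modz_nat cardT.
rewrite !eqz_mod_dvd => dT dS.
move: #|subF _| #|subF m| #|T1 _| #|T1 m| dT dS => a b c d dT dS.
have -> : a%:Z - 2 * c%:Z - (b%:Z - 2 * d%:Z) = (a%:Z - b%:Z) - 2 * (c%:Z - d%:Z) by ring.
by rewrite rpredB // dvdz_mull.
Qed.

(** The squares agree, so only a sign is open. The case m / p gives a congruence modulo the odd
    prime p; opposite signs would make p divide twice [gauss_trace m], whose square is 2^(m+3). *)
Lemma subsum_gauss_trace m : (m %| n)%N -> subsum m = gauss_trace m.
Proof.
elim/ltn_ind: m => m IH mn.
have n0 : (0 < n)%N by exact: odd_gt0.
have m0 : (0 < m)%N by apply: dvdn_gt0 mn.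
have [->|m_neq1] := eqVneq m 1%N.
  have S01 : subF 1 = [set 0; 1].
    apply/setP => x; rewrite !inE -subr_eq0 -[X in _ - X]mulr1 expr2 -mulrBr mulf_eq0.
    by rewrite subr_eq0.
  rewrite /subsum S01 big_setU1 ?inE 1?eq_sym ?oner_eq0 // big_set1.
  by rewrite expr0n expr1n /= addr0 addxx // (chi0 cardF).
have p_prime : prime (pdiv m) by rewrite pdiv_prime // ltn_neqAle eq_sym m_neq1.
have m_odd : odd m by apply: dvdn_odd mn odd_n.
have p_odd : odd (pdiv m) by apply: dvdn_odd (pdiv_dvd m) m_odd.
have /dvdnP[k mE] := pdiv_dvd m; move: (pdiv m) p_prime p_odd mE => p p_prime p_odd mE.
have k0 : (0 < k)%N by move: m0; rewrite mE muln_gt0 => /andP[].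
have km : (k < m)%N by rewrite mE ltn_Pmulr // prime_gt1.
have kn : (k %| n)%N by apply: dvdn_trans mn; rewrite mE dvdn_mulr.
have E : (subsum m = gauss_trace m %[mod p])%Z.
  by rewrite mE subsum_prime // IH // gauss_trace_prime.
have /eqP : subsum m ^+ 2 = gauss_trace m ^+ 2 by rewrite subsum_sqr // gauss_trace_sqr.
rewrite eqf_sqr => /orP[/eqP //|/eqP SN].
move/eqP: E; rewrite SN eqz_mod_dvd -opprD dvdzE abszN -dvdzE => pD.
have : (p %| 2 ^+ m.+3)%Z.
  have -> : 2 ^+ m.+3 = (gauss_trace m + gauss_trace m) ^+ 2.
    transitivity (2 ^+ 2 * gauss_trace m ^+ 2); last by ring.
    by rewrite gauss_trace_sqr // -exprD.
  by rewrite expr2 dvdz_mull.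
rewrite dvdzE abszX Euclid_dvdX // andbT => /dvdn_leq p2.
by have := prime_gt1 p_prime; have := p2 isT; move: p_odd; case: (p) => [|[|[|]]].
Qed.

Lemma cubicsum1 : cubicsum n (1 : F) = gauss_trace n.
Proof.
rewrite -subsum_gauss_trace //; apply: eq_big => [x|x _]; last by rewrite mul1r.
by rewrite inE expF // eqxx.
Qed.

End SubfieldSums.

(** * Combination modulo 48 *)

Unset Implicit Arguments.

Theorem theorem6p1 (n : nat) (hn5 : (5 <= n)%N) (hodd : odd n)
    (F : finFieldType) (hF : #|F| = (2 ^ n)%N) (a : F) (ha : a != 0) :
  exists c : F, unique (fun c' : F => c' ^+ 3 = a) c /\
  (absTr n c = 0 ->
    (absTr n a = 1 -> Q n a = 1 -> (kloosterman n a = 4 %[mod 48])%Z) /\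
    (absTr n a = 0 -> Q n a = 0 -> (kloosterman n a = 16 %[mod 48])%Z) /\
    (absTr n a = 1 -> Q n a = 0 -> (kloosterman n a = 28 %[mod 48])%Z) /\
    (absTr n a = 0 -> Q n a = 1 -> (kloosterman n a = 40 %[mod 48])%Z)) /\
  (absTr n c = 1 ->
    exists beta : F,
      unique (fun b : F => absTr n b = 0 /\ c = b ^+ 4 + b + 1) beta /\
      let r := ((n + bit (absTr n (beta ^+ 3))) %% 8)%N in
      (absTr n a = 0 -> Q n a = 0 -> r = 5%N \/ r = 7%N ->
        (kloosterman n a = 0 %[mod 48])%Z) /\
      (absTr n a = 0 -> Q n a = 1 -> r = 1%N \/ r = 3%N ->
        (kloosterman n a = 8 %[mod 48])%Z) /\
      (absTr n a = 1 -> Q n a = 0 -> r = 5%N \/ r = 7%N ->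
        (kloosterman n a = 12 %[mod 48])%Z) /\
      (absTr n a = 1 -> Q n a = 1 -> r = 1%N \/ r = 3%N ->
        (kloosterman n a = 20 %[mod 48])%Z) /\
      (absTr n a = 0 -> Q n a = 1 -> r = 5%N \/ r = 7%N ->
        (kloosterman n a = 24 %[mod 48])%Z) /\
      (absTr n a = 0 -> Q n a = 0 -> r = 1%N \/ r = 3%N ->
        (kloosterman n a = 32 %[mod 48])%Z) /\
      (absTr n a = 1 -> Q n a = 1 -> r = 5%N \/ r = 7%N ->
        (kloosterman n a = 36 %[mod 48])%Z) /\
      (absTr n a = 1 -> Q n a = 0 -> r = 1%N \/ r = 3%N ->
        (kloosterman n a = 44 %[mod 48])%Z)).
Proof.
have n_gt3 : (3 < n)%N by apply: leq_trans hn5.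
have F_gt2 : (2 < #|F|)%N.
  by rewrite hF; apply: (@leq_trans (2 ^ 2)) => //; rewrite leq_exp2l // ltnW // ltnW.
have b0 : bit (0 : F) = 0%N by rewrite /bit eq_sym oner_eq0.
have b1 : bit (1 : F) = 1%N by rewrite /bit eqxx.
have cube_inj := @odd_cube_inj n F hodd hF.
have [root rootK cubeK] := injF_bij cube_inj.
exists (root a); split; first by split=> [|c']; [exact: cubeK | move<-; exact: rootK].
have K3 := kloosterman_mod3 hodd hF F_gt2 ha (cubeK a).
have K16 := kloosterman_mod16 hodd n_gt3 hF ha.
split=> Tc.
  (* The sum is thus 1 modulo 3, and [lia] combines this with the class modulo 16. *)
  rewrite (cubicsum_Tr0 hodd hF Tc) in K3.
  by repeat split; move=> Ta Qa; move: K16; rewrite Ta Qa ?b0 ?b1; lia.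
have [beta beta_uniq] := beta_uniqueness hodd hF Tc.
exists beta; split=> //=; have [[Tb cE] _] := beta_uniq.
(* The residues 1, 3, 5, 7 are odd and so is n, which forces Tr(beta^3) = 0; the sign chi(beta^3 +
   beta) is then 1. *)
have {}K3 : odd ((n + bit (absTr n (beta ^+ 3))) %% 8) ->
    (kloosterman n a = 2 * gauss_trace n + 1 %[mod 3])%Z /\
    (n + bit (absTr n (beta ^+ 3)) = n)%N.
  rewrite K3 cE (cubicsum_shift hF) (cubicsum1 hodd hF) /addchar TrD // Tb addr0.
  case: (absTr_F2 (beta ^+ 3) hF) => ->; rewrite ?b0 ?b1 => r_odd.
    by rewrite mul1r addn0.
  by exfalso; move: r_odd hodd; lia.
have {}K3 r : (r = (n + bit (absTr n (beta ^+ 3))) %% 8)%N -> odd r ->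
    (kloosterman n a = (if (r < 4)%N then 2 else 0) %[mod 3])%Z.
  move=> -> /K3[-> ->]; have := gauss_trace_mod3 hodd.
  by case: (n %% 8 < 4)%N; lia.
have {}K3 := K3 _ erefl; move: K3; set r := (_ %% 8)%N => K3.
by repeat split; move=> Ta Qa [] rE; move: K16 K3; rewrite Ta Qa rE ?b0 ?b1 /=; lia.
Qed.
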